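(* There are exactly 4 distinct cylinder diagrams (up to isomorphism) in $\mathcal H(1,1)$.
   Context: A separatrix diagram is a pair $(R(\Gamma),P)$ where: $\Gamma$ is a finite directed graph such that at each vertex the incident edge-ends are cyclically ordered, with orientations alternating between incoming and outgoing; $R(\Gamma)$ is the associated ribbon graph, i.e. the oriented surface with boundary obtained by thickening the edges of $\Gamma$ to oriented strips glued according to the cyclic orders at the vertices; and $P$ is a pairing (partition into two-element sets) of the boundary components of $R(\Gamma)$. Each boundary component carries two orientations, one as boundary of the oriented surface $R(\Gamma)$ and one induced by the directed edges of $\Gamma$ it runs parallel to; it is called positively oriented if these agree and negatively oriented if they do not. It is required that each pair in $P$ consists of one positively oriented and one negatively oriented component. A separatrix diagram is realizable if one can assign positive integer lengths to the edges of $\Gamma$ such that the two boundary components in each pair of $P$ have equal length, where the length of a boundary component is the sum of the lengths of the edges it runs along. A cylinder diagram is a realizable separatrix diagram. (Gluing metric cylinders between paired boundary components then gives a translation surface whose cone points are the vertices of $\Gamma$ and whose horizontal saddle connections are the edges of $\Gamma$.) The cylinder diagram is in $\mathcal H(1,1)$ (translation surfaces with exactly two cone points, each of angle $4\pi$) when $\Gamma$ has exactly two vertices, each of valence 4 (two incoming and two outgoing edge-ends). Two cylinder diagrams are considered the same if there is an isomorphism of directed graphs preserving the cyclic orders at vertices and the pairings of boundary components. *)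

(* Defs.v *)
From mathcomp Require Import all_boot all_fingroup.

Set Implicit Arguments.
Unset Strict Implicit.
Unset Printing Implicit Defensive.

(* Loops and multiple edges are allowed. *)
Record digraph := Digraph {
  vert : finType;
  edge : finType;
  src : edge -> vert;
  tgt : edge -> vert
}.

(* [(e, false)] is the tail of [e], outgoing at [src e]; [(e, true)] is its
   head, incoming at [tgt e].  The ends of a loop are distinct edge-ends. *)
Notation edge_end G := (edge G * bool)%type.

Definition incoming (G : digraph) (h : edge_end G) : bool := h.2.

Definition end_vert (G : digraph) (h : edge_end G) : vert G :=
  if incoming h then tgt h.1 else src h.1.

Definition opp_end (G : digraph) (h : edge_end G) : edge_end G :=
  (h.1, ~~ h.2).

Lemma opp_endK (G : digraph) : involutive (@opp_end G).
Proof. by case=> e b; rewrite /opp_end /= negbK. Qed.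

Definition opp_perm (G : digraph) : {perm edge_end G} :=
  perm (inv_inj (@opp_endK G)).

(* [rot h] is the edge-end following [h] counterclockwise around its vertex:
   [rot_orbit] says that [rot] is exactly a cyclic order on the set of
   edge-ends at each vertex. *)
Record ribbon := Ribbon {
  graph :> digraph;
  rot : {perm edge_end graph};
  rot_orbit : forall h : edge_end graph,
    porbit rot h = [set k | end_vert k == end_vert h];
  rot_alternating : forall h : edge_end graph,
    incoming (rot h) = ~~ incoming h
}.

(* Each edge strip of the ribbon graph has two sides.  The boundary orientation
   keeps the surface on the left, so it runs along one side from the tail to
   the head and along the other from the head to the tail; the edge-end [h]
   stands for the side of [h.1] traversed starting from [h].  This traversal
   ends at [opp_end h], and then goes along the strip of the next edge-end
   counterclockwise.  (In MathComp, [s * t] applies [s] first.) *)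
Definition bnext (G : ribbon) : {perm edge_end G} := (opp_perm G * rot G)%g.

(* A boundary component is the set of edge sides that it runs along. *)
Definition boundary_components (G : ribbon) : {set {set edge_end G}} :=
  porbits (bnext G).

(* A side agrees with the direction of its edge when its boundary traversal
   starts from the tail. *)
Definition positively_oriented (G : ribbon) (B : {set edge_end G}) : bool :=
  [forall h in B, ~~ incoming h].

Definition negatively_oriented (G : ribbon) (B : {set edge_end G}) : bool :=
  [forall h in B, incoming h].

Record separatrix_diagram := SeparatrixDiagram {
  ribbon_of :> ribbon;
  pairing : {set {set {set edge_end ribbon_of}}};
  pairing_partition : partition pairing (boundary_components ribbon_of);
  pairing_signs : forall p, p \in pairing ->
    exists B C : {set edge_end ribbon_of},
      [/\ p = [set B; C], B != C, positively_oriented B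
        & negatively_oriented C]
}.

Definition blength (G : ribbon) (len : edge G -> nat) (B : {set edge_end G}) :
    nat :=
  \sum_(h in B) len h.1.

Definition realizable (D : separatrix_diagram) : Prop :=
  exists len : edge D -> nat,
    (forall e, 0 < len e) /\
    (forall p B C, p \in pairing D -> B \in p -> C \in p ->
       blength len B = blength len C).

Record cylinder_diagram := CylinderDiagram {
  diagram :> separatrix_diagram;
  diagram_realizable : realizable diagram
}.

Definition valence (G : digraph) (v : vert G) : nat :=
  #|[set h : edge_end G | end_vert h == v]|.

Definition in_H11 (D : cylinder_diagram) : Prop :=
  #|vert D| = 2 /\ (forall v : vert D, valence v = 4).

Definition end_map (G1 G2 : digraph) (fE : edge G1 -> edge G2)
    (h : edge_end G1) : edge_end G2 :=
  (fE h.1, h.2).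

Definition isomorphic (D1 D2 : separatrix_diagram) : Prop :=
  exists (fV : vert D1 -> vert D2) (fE : edge D1 -> edge D2),
    [/\ bijective fV /\ bijective fE,
        forall e, src (fE e) = fV (src e) /\ tgt (fE e) = fV (tgt e),
        forall h, rot D2 (end_map fE h) = end_map fE (rot D1 h)
      & pairing D2 =
          [set [set end_map fE @: B | B : {set edge_end D1} in p]
             | p : {set {set edge_end D1}} in pairing D1]].

(* Main.v *)
Require Import Defs.
From mathcomp Require Import all_boot all_fingroup.

Set Implicit Arguments.
Unset Strict Implicit.
Unset Printing Implicit Defensive.

(* In a diagram with two vertices of valence 4 there are 4 edges.  Turning twice
   around the vertex of an outgoing end gives a fixed-point-free involution of
   the edges, so they can be labelled 0, 1, 2, 3 with this involution equal to
   (0 1)(2 3).  Following the incoming sides of the edges (the negative boundary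
   components) is then an arbitrary permutation [a] of the labels, and following
   the outgoing sides (the positive components) is (0 1)(2 3) composed with the
   inverse of [a].  The pairing matches the cycles of these two permutations, and
   realizability forbids the edges of a component to be a proper subset of those
   of its partner.  It remains to inspect finitely many permutations and matchings:
   up to relabelling, exactly four survive, and all of them are realized by
   edges of length 1. *)

(** * Boundary components as cycles of edges *)

Section RibbonSides.

Variable G : ribbon.
Implicit Types (e f : edge G) (b : bool) (h : edge_end G).

(* [b = false] follows the side traversed from the tail, [b = true] the one
   traversed from the head. *)
Definition side_next b e : edge G := (Defs.rot G (e, ~~ b)).1.

Lemma rotE e b : Defs.rot G (e, b) = (side_next (~~ b) e, ~~ b).
Proof.
rewrite /side_next negbK; have := rot_alternating (e, b).
by case: (Defs.rot G (e, b)) => f c; rewrite /incoming /= => ->.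
Qed.

(** [opp_perm] and [rot] each exchange heads and tails, so a boundary traversal never changes
    direction; this is why every component has a sign. *)
Lemma bnextE e b : bnext G (e, b) = (side_next b e, b).
Proof. by rewrite /bnext permM permE /opp_end /= rotE !negbK. Qed.

Lemma iter_bnext n e b : iter n (bnext G) (e, b) = (iter n (side_next b) e, b).
Proof. by elim: n => //= n ->; rewrite bnextE. Qed.

Lemma side_next_inj b : injective (side_next b).
Proof.
move=> e f eq_ef; have: bnext G (e, b) = bnext G (f, b) by rewrite !bnextE eq_ef.
by move/perm_inj => [].
Qed.

Definition side e b : {set edge_end G} := porbit (bnext G) (e, b).

(** The number of all edge-ends bounds the length of every cycle, which gives one bound for all
    components. *)
Lemma mem_side e b f c :
  ((f, c) \in side e b) =
  (c == b) && (f \in traject (side_next b) e #|{: edge_end G}|).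
Proof.
apply/idP/andP=> [|[/eqP-> /trajectP[n _ ->]]]; last first.
  by rewrite -iter_bnext -permX mem_porbit.
rewrite /side porbit_traject => /trajectP[n lt_n].
rewrite iter_bnext => -[-> ->]; split=> //; apply/trajectP; exists n => //.
exact: leq_trans lt_n (max_card _).
Qed.

Lemma side_refl e b : (e, b) \in side e b.
Proof. exact: porbit_id. Qed.

Lemma side_eq e b f c : (side e b == side f c) = ((f, c) \in side e b).
Proof. by rewrite /side eq_porbit_mem porbit_sym. Qed.

Lemma side_eqP e b f c : reflect (side e b = side f c) ((f, c) \in side e b).
Proof. by rewrite -side_eq; apply: eqP. Qed.

Lemma side_incoming e b h : h \in side e b -> incoming h = b.
Proof. by case: h => f c; rewrite mem_side => /andP[/eqP-> _]. Qed.

Lemma side_boundary e b : side e b \in boundary_components G.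
Proof. exact: imset_f. Qed.

Lemma boundary_componentP (B : {set edge_end G}) :
  reflect (exists e b, B = side e b) (B \in boundary_components G).
Proof.
apply: (iffP imsetP) => [[[e b] _ ->]|[e [b ->]]]; first by exists e, b.
by exists (e, b).
Qed.

Lemma side_signed e b :
  if b then negatively_oriented (side e b) else positively_oriented (side e b).
Proof.
by case: b; apply/forall_inP => h /side_incoming ->.
Qed.

Lemma positive_side (B : {set edge_end G}) : B \in boundary_components G ->
  positively_oriented B -> exists e, B = side e false.
Proof.
case/boundary_componentP=> e [b ->] /forall_inP/(_ _ (side_refl e b)).
by case: b => // _; exists e.
Qed.

Lemma negative_side (B : {set edge_end G}) : B \in boundary_components G ->
  negatively_oriented B -> exists e, B = side e true.
Proof.
case/boundary_componentP=> e [b ->] /forall_inP/(_ _ (side_refl e b)).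
by case: b => // _; exists e.
Qed.

(** The sign tells the two members of an unordered pair apart. *)
Lemma side_pair_inj e f e' f' :
  [set side e false; side f true] = [set side e' false; side f' true] ->
  side e false = side e' false /\ side f true = side f' true.
Proof.
move=> eq_p; split.
  have: side e false \in [set side e' false; side f' true].
    by rewrite -eq_p set21.
  by case/set2P => // /eqP; rewrite side_eq mem_side.
have: side f true \in [set side e' false; side f' true].
  by rewrite -eq_p set22.
by case/set2P => // /eqP; rewrite side_eq mem_side.
Qed.

Lemma blength_side (len : edge G -> nat) e b :
  blength len (side e b) = \sum_(f | (f, b) \in side e b) len f.
Proof.
rewrite /blength (reindex_onto (fun f => (f, b)) fst) /=; last first.
  by case=> f c /side_incoming; rewrite /incoming /= => ->.
by apply: eq_bigl => f; rewrite eqxx andbT.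
Qed.

Lemma card_side e b : #|side e b| = #|[pred f | (f, b) \in side e b]|.
Proof. by rewrite -!sum1_card; apply: (blength_side (fun=> 1)). Qed.

End RibbonSides.

Arguments side_eqP {G e b f c}.

(** * The pairing as a relation between edges *)

Section Paired.

Variable D : separatrix_diagram.
Implicit Types e f : edge D.

Definition paired e f : bool := [set side e false; side f true] \in pairing D.

Lemma pairingP p :
  reflect (exists e f, paired e f /\ p = [set side e false; side f true])
    (p \in pairing D).
Proof.
apply: (iffP idP) => [Dp|[e [f [ef ->]]] //].
have [B [C [def_p _ posB negC]]] := pairing_signs Dp.
have bd A : A \in p -> A \in boundary_components D.
  rewrite -(cover_partition (pairing_partition D)) => Ap.
  by apply/bigcupP; exists p.
have [|e defB] := positive_side _ posB; first by rewrite bd // def_p set21.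
have [|f defC] := negative_side _ negC; first by rewrite bd // def_p set22.
by exists e, f; rewrite /paired -defB -defC -def_p.
Qed.

Lemma pairing_uniq p q A :
  p \in pairing D -> q \in pairing D -> A \in p -> A \in q -> p = q.
Proof.
have /and3P[_ trivD _] := pairing_partition D.
by move=> Dp Dq Ap Aq; rewrite -(def_pblock trivD Dp Ap) (def_pblock trivD Dq Aq).
Qed.

(** Blocks of a partition that share a component coincide, so [paired] matches positive and negative
    cycles one to one. *)
Lemma paired_side e f e' f' : paired e f -> paired e' f' ->
  ((e', false) \in side e false) = ((f', true) \in side f true).
Proof.
move=> ef e'f'; rewrite -!side_eq; apply/eqP/eqP => eq_side.
  have e_f': side e false \in [set side e' false; side f' true].
    by rewrite eq_side set21.
  by case/side_pair_inj: (pairing_uniq ef e'f' (set21 _ _) e_f').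
have f_e': side f true \in [set side e' false; side f' true].
  by rewrite eq_side set22.
by case/side_pair_inj: (pairing_uniq ef e'f' (set22 _ _) f_e').
Qed.

Lemma paired_invariant e f e' f' : paired e f ->
  (e', false) \in side e false -> (f', true) \in side f true -> paired e' f'.
Proof. by rewrite -!side_eq /paired => ef /eqP<- /eqP<-. Qed.

Lemma paired_total e : exists f, paired e f.
Proof.
have: side e false \in cover (pairing D).
  by rewrite (cover_partition (pairing_partition D)) side_boundary.
case/bigcupP=> p /pairingP[e' [f [e'f ->]]] /set2P[|/eqP].
  by move=> eq_e; exists f; rewrite /paired eq_e.
by rewrite side_eq mem_side.
Qed.

Lemma paired_surj f : exists e, paired e f.
Proof.
have: side f true \in cover (pairing D).
  by rewrite (cover_partition (pairing_partition D)) side_boundary.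
case/bigcupP=> p /pairingP[e [f' [ef' ->]]] /set2P[/eqP|].
  by rewrite side_eq mem_side.
by move=> eq_f; exists e; rewrite /paired eq_f.
Qed.

End Paired.

(** * Positive lengths and inclusion of components *)

(** The elements of [B] outside [A] have total length 0, while each has positive length. *)
Lemma sum_pos_subset (T : finType) (len : T -> nat) (A B : {set T}) :
  (forall x, 0 < len x) -> A \subset B ->
  \sum_(x in A) len x = \sum_(x in B) len x -> B \subset A.
Proof.
move=> len_gt0 sAB; rewrite (big_setID A (A := B)) /= (setIidPr sAB).
rewrite -[LHS]addn0 => /addnI/esym/eqP; rewrite sum_nat_eq0 => /forall_inP sum0.
apply/subsetP => x Bx; apply: contraTT (len_gt0 x) => A'x.
by rewrite -leqNgt leqn0 sum0 // inE A'x.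
Qed.

(** This is the only consequence of realizability that the classification uses: paired components
    have equal length, so neither edge set is properly contained in the other. *)
Lemma realizable_paired_subset (D : separatrix_diagram) (e f : edge D) :
  realizable D -> paired e f ->
  ([set x | (x, false) \in side e false] \subset
     [set x | (x, true) \in side f true]) =
  ([set x | (x, true) \in side f true] \subset
     [set x | (x, false) \in side e false]).
Proof.
case=> len [len_gt0 len_eq] ef.
have := len_eq _ _ _ ef (set21 _ _) (set22 _ _).
rewrite !blength_side => eq_len.
have eq_sum: \sum_(x in [set x | (x, false) \in side e false]) len x =
             \sum_(x in [set x | (x, true) \in side f true]) len x.
  under eq_bigl do rewrite inE; rewrite eq_len.
  by apply: eq_bigl => x; rewrite inE.
by apply/idP/idP => sub; apply: (sum_pos_subset len_gt0 sub); rewrite eq_sum.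
Qed.

(** * Isomorphisms described on edges *)

Section Isomorphism.

Variables (D1 D2 : separatrix_diagram) (fE : edge D1 -> edge D2).
Hypothesis fE_bij : bijective fE.
Hypothesis fE_next : forall b e, side_next b (fE e) = fE (side_next b e).

Lemma end_map_inj : injective (end_map (G1 := D1) (G2 := D2) fE).
Proof. by case=> e b [f c] [/(bij_inj fE_bij)-> ->]. Qed.

Lemma end_map_side e b : end_map fE @: side e b = side (fE e) b.
Proof.
have iter_fE n x : iter n (side_next b) (fE x) = fE (iter n (side_next b) x).
  by elim: n => //= n ->.
apply/setP=> -[f c]; apply/imsetP/idP => [[[x d]]|].
  rewrite mem_side => /andP[/eqP-> /trajectP[n _ ->]] [-> ->].
  by rewrite -iter_fE -iter_bnext -permX mem_porbit.
rewrite mem_side => /andP[/eqP-> /trajectP[n _ ->]].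
exists (iter n (side_next b) e, b); last by rewrite /end_map /= iter_fE.
by rewrite -iter_bnext -permX mem_porbit.
Qed.

Lemma end_map_pair e f :
  [set end_map fE @: B
     | B : {set edge_end D1} in [set side e false; side f true]]
  = [set side (fE e) false; side (fE f) true].
Proof. by rewrite imsetU1 imset_set1 !end_map_side. Qed.

Lemma end_map_rot h : Defs.rot D2 (end_map fE h) = end_map fE (Defs.rot D1 h).
Proof. by case: h => e b; rewrite /end_map /= !rotE fE_next. Qed.

(** Vertices are the orbits of [rot], and [end_map fE] commutes with [rot]; hence the edge map
    determines the vertex map, provided every vertex carries an edge-end. *)
Lemma isomorphic_of_edges :
  (forall e f, paired (fE e) (fE f) = paired e f) ->
  (forall v : vert D1, exists h : edge_end D1, end_vert h = v) ->
  #|vert D1| = #|vert D2| -> isomorphic D1 D2.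
Proof.
move=> fE_paired vert_end eq_card.
have vert_endb v : exists h : edge_end D1, end_vert h == v.
  by have [h <-] := vert_end v; exists h.
pose end_at v := xchoose (vert_endb v).
have end_atK v : end_vert (end_at v) = v := eqP (xchooseP (vert_endb v)).
pose fV v := end_vert (end_map fE (end_at v)).
have same_vert (h k : edge_end D1) : (end_vert h == end_vert k) =
    (end_vert (end_map fE h) == end_vert (end_map fE k)).
  have mem_rot (G : ribbon) (x y : edge_end G) :
      (end_vert x == end_vert y) = (x \in porbit (Defs.rot G) y).
    by rewrite rot_orbit inE.
  rewrite !mem_rot.
  have iter_rot n x : iter n (Defs.rot D2) (end_map fE x) =
      end_map fE (iter n (Defs.rot D1) x).
    by elim: n => //= n ->; rewrite end_map_rot.
  apply/porbitP/porbitP => -[n eq_n]; exists n.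
    by rewrite eq_n !permX iter_rot.
  by apply: end_map_inj; rewrite eq_n !permX iter_rot.
have fV_end h : end_vert (end_map fE h) = fV (end_vert h).
  by apply/eqP; rewrite -same_vert end_atK.
exists fV, fE; split.
- split=> //; apply: inj_card_bij; last by rewrite eq_card.
  by move=> v w /eqP; rewrite /fV -same_vert !end_atK => /eqP.
- by move=> e; split; [apply: (fV_end (e, false)) | apply: (fV_end (e, true))].
- exact: end_map_rot.
apply/setP=> p; apply/pairingP/imsetP => [[e' [f' [e'f' ->]]]|[q]].
  have [gE _ gEK] := fE_bij.
  exists [set side (gE e') false; side (gE f') true].
    by rewrite -[_ \in _]/(paired _ _) -fE_paired !gEK.
  by rewrite end_map_pair !gEK.
case/pairingP=> e [f [ef ->]] ->; exists (fE e), (fE f).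
by rewrite fE_paired end_map_pair.
Qed.

End Isomorphism.

Lemma isomorphic_edges (D1 D2 : separatrix_diagram) : isomorphic D1 D2 ->
  exists fE : edge D1 -> edge D2,
    [/\ bijective fE, forall b e, side_next b (fE e) = fE (side_next b e)
      & forall e f, paired (fE e) (fE f) = paired e f].
Proof.
case=> fV [fE [[_ fE_bij] _ fE_rot fE_pairing]].
have fE_next b e : side_next b (fE e) = fE (side_next b e).
  by have := fE_rot (e, ~~ b); rewrite /end_map /= !rotE negbK => -[].
exists fE; split=> // e f.
rewrite /paired fE_pairing -(end_map_pair fE_next) mem_imset //.
(* A pair is a set of sets of edge-ends, so injectivity is lifted through two levels of images. *)
by do 2!apply: imset_inj; apply: end_map_inj.
Qed.

(** * Diagrams built from two permutations of the edges *)

(* [next true] and [next false] prescribe [side_next], and [M] prescribes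
   [paired]; the vertices are the orbits of [next false \o next true]. *)
Section Construction.

Variables (T V : finType) (base : T -> V) (next : bool -> T -> T) (M : rel T).
Hypothesis next_inj : forall b, injective (next b).
Hypothesis base_next : forall e f, reflect
  (exists n, f = iter n (next false \o next true) e) (base f == base e).

(** The head of [e] will be followed by the tail of [next false e], so both must lie at the same
    vertex; this dictates the target map. *)
Definition next_digraph : digraph := Digraph base (base \o next false).

Definition next_rot (h : edge_end next_digraph) : edge_end next_digraph :=
  (next (~~ h.2) h.1, ~~ h.2).

Lemma next_rot_inj : injective next_rot.
Proof.
case=> e b [f c] [] eq_ef /negb_inj eq_bc; move: eq_ef.
by rewrite /= eq_bc => /next_inj->.
Qed.

Lemma base_iter n e : base (iter n (next false \o next true) e) = base e.
Proof. by apply/eqP/base_next; exists n. Qed.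

Lemma end_vert_next_rot h : end_vert (next_rot h) = end_vert h.
Proof. by case: h => e [] //; apply: (base_iter 1). Qed.

(** One rotation turns a head into a tail, so both ends may be taken to be tails. On tails two
    rotations act as [next false \o next true], and [base_next] applies. *)
Lemma next_rot_orbit h :
  porbit (perm next_rot_inj) h = [set k | end_vert k == end_vert h].
Proof.
set r := perm next_rot_inj.
have rE k : r k = next_rot k by rewrite permE.
have porbit_r k : porbit r (next_rot k) = porbit r k.
  by have := porbit_perm r 1 k; rewrite expg1 rE.
wlog tail_h : h / h.2 = false => [IH|].
  case def_b: h.2; last exact: IH.
  by rewrite -porbit_r IH ?end_vert_next_rot //= def_b.
case: h tail_h => e b /= ->{b}; apply/setP=> k; rewrite inE.
apply/idP/idP => [/porbitP[n ->]|].
  apply/eqP; elim: n => [|n IHn]; first by rewrite expg0 perm1.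
  by rewrite expgSr permM rE end_vert_next_rot.
wlog tail_k : k / k.2 = false => [IH|].
  case def_b: k.2; last exact: IH.
  rewrite -eq_porbit_mem -porbit_r eq_porbit_mem -end_vert_next_rot.
  by apply: IH; rewrite /= def_b.
case: k tail_k => f b /= ->{b} /base_next/= [n ->{f}].
elim: n => [|n IHn] /=; first exact: porbit_id.
rewrite -!eq_porbit_mem in IHn *; rewrite -(eqP IHn).
set x := iter n _ e; rewrite -(porbit_r (x, false)).
by rewrite -(porbit_r (next_rot (x, false))).
Qed.

Lemma next_rot_alternating h :
  incoming (perm next_rot_inj h) = ~~ incoming h.
Proof. by rewrite permE. Qed.

Definition next_ribbon : ribbon :=
  Ribbon next_rot_orbit next_rot_alternating.

Lemma next_ribbon_side_next b (e : T) :
  side_next (G := next_ribbon) b e = next b e.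
Proof. by rewrite /side_next permE /next_rot /= negbK. Qed.

Let pos (e : T) := side (G := next_ribbon) e false.
Let neg (f : T) := side (G := next_ribbon) f true.

(** These four hypotheses say that [M] comes from a bijection between positive and negative
    cycles. *)
Hypothesis M_side : forall e f e' f', M e f -> M e' f' ->
  (((e', false) \in pos e) = ((f', true) \in neg f)).
Hypothesis M_invariant : forall e f e' f', M e f ->
  (e', false) \in pos e -> (f', true) \in neg f -> M e' f'.
Hypothesis M_total : forall e, exists f, M e f.
Hypothesis M_surj : forall f, exists e, M e f.

Definition next_pairing : {set {set {set edge_end next_ribbon}}} :=
  [set [set pos x.1; neg x.2] | x : T * T in [pred x | M x.1 x.2]].

Lemma next_pairingP p :
  reflect (exists e f, M e f /\ p = [set pos e; neg f]) (p \in next_pairing).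
Proof.
apply: (iffP imsetP) => [[[e f] /= Mef ->]|[e [f [Mef ->]]]].
  by exists e, f.
by exists (e, f).
Qed.

Lemma next_pairing_partition :
  partition next_pairing (boundary_components next_ribbon).
Proof.
apply/and3P; split.
- apply/eqP/setP=> B; apply/bigcupP/idP.
    by case=> p /next_pairingP[e [f [_ ->]]] /set2P[] ->; apply: side_boundary.
  case/boundary_componentP=> e [[] ->].
    have [e' Me'e] := M_surj e; exists [set pos e'; neg e]; last exact: set22.
    by apply/next_pairingP; exists e', e.
  have [f Mef] := M_total e; exists [set pos e; neg f]; last exact: set21.
  by apply/next_pairingP; exists e, f.
- apply/trivIsetP=> p q /next_pairingP[e [f [Mef ->]]].
  case/next_pairingP=> e' [f' [Me'f' ->]]; apply: contraR.
  (* Of the four ways to share a component, two would identify opposite signs; the other two make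
     the pairs equal by [M_side]. *)
  case/pred0Pn=> B /andP[] /= /set2P[] -> /set2P[]
    /(introT (side_eqP (G := next_ribbon))).
  + move=> pos_e'; have neg_f' := pos_e'; rewrite (M_side Mef Me'f') in neg_f'.
    by rewrite /pos /neg (side_eqP pos_e') (side_eqP neg_f').
  + by rewrite mem_side.
  + by rewrite mem_side.
  + move=> neg_f'; have pos_e' := neg_f'; rewrite -(M_side Mef Me'f') in pos_e'.
    by rewrite /pos /neg (side_eqP pos_e') (side_eqP neg_f').
- apply/next_pairingP=> -[e [f [_ /setP/(_ (pos e))]]].
  by rewrite set21 inE.
Qed.

Lemma next_pairing_signs p : p \in next_pairing ->
  exists B C : {set edge_end next_ribbon},
    [/\ p = [set B; C], B != C, positively_oriented B & negatively_oriented C].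
Proof.
case/next_pairingP=> e [f [_ ->]]; exists (pos e), (neg f); split=> //.
- by rewrite side_eq mem_side.
- exact: (side_signed (G := next_ribbon) e false).
- exact: (side_signed (G := next_ribbon) f true).
Qed.

Definition next_diagram : separatrix_diagram :=
  SeparatrixDiagram next_pairing_partition next_pairing_signs.

Lemma next_diagram_paired (e f : T) : paired (D := next_diagram) e f = M e f.
Proof.
apply/next_pairingP/idP => [[e' [f' [Me'f' /side_pair_inj[/eqP + /eqP]]]]|Mef].
  rewrite [_ == _]eq_sym side_eq => pos_e'; rewrite [_ == _]eq_sym side_eq.
  exact: M_invariant pos_e'.
by exists e, f.
Qed.

Lemma next_diagram_realizable :
  (forall e f, M e f -> #|pos e| = #|neg f|) -> realizable next_diagram.
Proof.
move=> M_card; exists (fun=> 1); split=> // p B C /next_pairingP[e [f [Mef ->]]].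
by move=> /set2P[] -> /set2P[] ->;
  rewrite /blength !sum1_card // (M_card _ _ Mef).
Qed.

(** There are as many heads as tails at [v], since the target map is [base] after the bijection
    [next false]. *)
Lemma next_digraph_valence (v : V) :
  valence (G := next_digraph) v = (#|[set e | base e == v]|).*2.
Proof.
have valE b : \sum_(e : T | end_vert (G := next_digraph) (e, b) == v) 1 =
    #|[set e | base e == v]|.
  rewrite -sum1dep_card; case: b => //.
  by rewrite [RHS](reindex_inj (@next_inj false)).
rewrite /valence -addnn -{1}(valE true) -(valE false) -sum1dep_card.
rewrite (eq_bigl (fun h => end_vert (G := next_digraph) (h.1, h.2) == v));
  last by case.
rewrite -(pair_big_dep xpredT
  (fun e b => end_vert (G := next_digraph) (e, b) == v)
  (fun _ _ => 1)) /=.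
rewrite [X in X + _]big_mkcond [X in _ + X]big_mkcond -big_split.
by apply: eq_bigr => e _; rewrite big_mkcond big_bool.
Qed.

End Construction.

(** * Codes of diagrams and their enumeration *)

(* A diagram on the edges 0, 1, 2, 3 is encoded by a pair [(a, g)]: [a] lists the
   values of [side_next true], and [g] lists, for each edge [i], an edge whose
   negative side is paired with the positive side of [i]. *)
Definition code := (seq nat * seq nat)%type.

(** The involution (0 1)(2 3), the effect on outgoing ends of turning twice around a vertex. *)
Definition swap i := nth 0 [:: 1; 0; 3; 2] i.

(** Here [index] inverts the permutation [c.1], so following [true] and then [false] gives
    [swap]. *)
Definition code_next (c : code) b i :=
  if b then nth 0 c.1 i else swap (index i c.1).

(* There are 8 edge-ends, so 8 steps go through the whole cycle. *)
Definition code_side (c : code) b i := traject (code_next c b) i 8.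

Definition code_paired (c : code) i j := j \in code_side c true (nth 0 c.2 i).

(** The hypotheses on [M] in the construction above in computable form, with equal edge counts for
    paired components so that unit lengths realize the diagram. *)
Definition code_valid (c : code) :=
  let I := iota 0 4 in
  [&& all (fun i => has (code_paired c i) I) I,
      all (fun j => has (code_paired c ^~ j) I) I
    & all (fun i => all (fun j => code_paired c i j ==>
        (count (mem (code_side c false i)) I ==
         count (mem (code_side c true j)) I)
        && all (fun i' => all (fun j' =>
           let pos := i' \in code_side c false i in
           let neg := j' \in code_side c true j in
           (code_paired c i' j' ==> (pos == neg)) &&
           (pos && neg ==> code_paired c i' j')) I) I) I) I].

(* Choosing the least label of each cycle makes the list [g] of a code unique. *)
Definition cycle_roots (a : seq nat) :=
  [seq i <- iota 0 4 | all (leq i) (traject (nth 0 a) i 8)].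

(* Necessary conditions for [c] to come from a realizable diagram, cheaper to
   compute than [code_valid]. *)
Definition code_admissible (c : code) :=
  let I := iota 0 4 in
  let g := nth 0 c.2 in
  let sub s t := all (fun k => (k \in s) ==> (k \in t)) I in
  [&& all (mem c.2) (cycle_roots c.1),
      all (fun i => g (code_next c false i) == g i) I,
      all (fun i => all (fun j =>
        (g i == g j) ==> (j \in code_side c false i)) I) I
    & all (fun i => sub (code_side c false i) (code_side c true (g i)) ==
                    sub (code_side c true (g i)) (code_side c false i)) I].

Definition code_iso (c d : code) (p : seq nat) :=
  let I := iota 0 4 in
  all (fun i =>
    all (fun b => code_next d b (nth 0 p i) == nth 0 p (code_next c b i))
      [:: true; false] &&
    all (fun j =>
      code_paired d (nth 0 p i) (nth 0 p j) == code_paired c i j) I) I.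

Definition code_isomorphic c d := has (code_iso c d) (permutations (iota 0 4)).

(* One cylinder; two cylinders with boundary components of 3 and 1 edges, then
   of 2 and 2 edges; three cylinders. *)
Definition canonical_codes : seq code :=
  [:: ([:: 2; 3; 1; 0], [:: 0; 0; 0; 0]); ([:: 0; 2; 3; 1], [:: 1; 1; 1; 0]);
      ([:: 2; 3; 0; 1], [:: 0; 1; 1; 0]); ([:: 0; 1; 3; 2], [:: 2; 2; 0; 1])].

Definition canonical i := nth ([::], [::]) canonical_codes i.

Lemma canonical_valid :
  all (fun c => (c.1 \in permutations (iota 0 4)) && code_valid c)
    canonical_codes.
Proof. by vm_compute. Qed.

Lemma canonical_distinct :
  all (fun i => all (fun j =>
    code_isomorphic (canonical i) (canonical j) ==> (i == j))
    (iota 0 4)) (iota 0 4).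
Proof. by vm_compute. Qed.

(* [if] rather than [==>], as [vm_compute] evaluates both arguments of [==>]. *)
Definition code_classified (c : code) :=
  if code_admissible c then
    has (fun i => code_isomorphic c (canonical i)) (iota 0 4)
  else true.

(** Every negative component has a least label, so letting the entries of [g] range over
    [cycle_roots a] covers all pairings. *)
Lemma canonical_complete :
  all (fun a => let I := cycle_roots a in
    all (fun g0 => all (fun g1 => all (fun g2 => all (fun g3 =>
      code_classified (a, [:: g0; g1; g2; g3])) I) I) I) I)
    (permutations (iota 0 4)).
Proof. by vm_compute. Qed.

(** * Comparing labelled diagrams with their codes *)

Lemma all_iota_ord n (P : pred nat) :
  all P (iota 0 n) = [forall i : 'I_n, P i].
Proof.
apply/allP/forallP => [Pn i|Pn i]; first by apply: Pn; rewrite mem_iota /=.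
rewrite mem_iota => lt_in; exact: (Pn (Ordinal lt_in)).
Qed.

Lemma has_iota_ord n (P : pred nat) :
  has P (iota 0 n) = [exists i : 'I_n, P i].
Proof.
by apply: negb_inj; rewrite -all_predC all_iota_ord negb_exists.
Qed.

Lemma count_iota_ord n (P : pred nat) :
  count P (iota 0 n) = #|[pred i : 'I_n | P i]|.
Proof. by rewrite -val_enum_ord count_map cardE size_filter enumT. Qed.

Lemma perm_eq_iota n (s : seq nat) :
  uniq s -> size s = n -> all (gtn n) s -> perm_eq s (iota 0 n).
Proof.
move=> uniq_s size_s /allP s_lt; apply: uniq_perm; rewrite ?iota_uniq //.
have [||//] := @uniq_min_size _ s (iota 0 n) uniq_s.
  by move=> i /s_lt; rewrite mem_iota.
by rewrite size_iota size_s.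
Qed.

Definition encodes_next (G : ribbon) (idx : edge G -> 'I_4) (c : code) :=
  forall b e, idx (side_next b e) = code_next c b (idx e) :> nat.

Definition encodes (D : separatrix_diagram) (idx : edge D -> 'I_4) (c : code) :=
  [/\ bijective idx, encodes_next idx c
    & forall e f, paired e f = code_paired c (idx e) (idx f)].

Section EncodesSide.

Variables (G : ribbon) (idx : edge G -> 'I_4) (c : code).
Hypotheses (idx_bij : bijective idx) (idx_next : encodes_next idx c).

Lemma encodes_iter b e n :
  iter n (code_next c b) (idx e) = idx (iter n (side_next b) e).
Proof. by elim: n => //= n ->; rewrite idx_next. Qed.

Lemma encodes_side b e f :
  ((f, b) \in side e b) = (nat_of_ord (idx f) \in code_side c b (idx e)).
Proof.
(* The number of edge-ends becomes 4 * 2, the 8 steps of [code_side]. *)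
rewrite mem_side eqxx card_prod card_bool (bij_eq_card idx_bij) card_ord.
apply/trajectP/trajectP => -[n lt_n eq_f]; exists n => //.
  by rewrite encodes_iter -eq_f.
by apply: (bij_inj idx_bij); apply: ord_inj; rewrite eq_f encodes_iter.
Qed.

Lemma code_sideP b e k : k \in code_side c b (idx e) ->
  exists2 f, k = idx f & (f, b) \in side e b.
Proof.
case/trajectP=> n _; rewrite encodes_iter => ->.
exists (iter n (side_next b) e) => //.
by rewrite -iter_bnext -permX mem_porbit.
Qed.

Lemma encodes_subset b d e f :
  all (fun k => (k \in code_side c b (idx e)) ==> (k \in code_side c d (idx f)))
      (iota 0 4) =
  ([set x | (x, b) \in side e b] \subset [set x | (x, d) \in side f d]).
Proof.
apply/allP/subsetP => sub x.
  rewrite !inE !encodes_side; apply/implyP/sub.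
  by rewrite mem_iota ltn_ord.
move=> _; apply/implyP=> /code_sideP[y -> side_y].
by rewrite -encodes_side; have := sub y; rewrite !inE; apply.
Qed.

End EncodesSide.

Lemma encodes_isomorphic (D1 D2 : separatrix_diagram)
    (idx1 : edge D1 -> 'I_4) (idx2 : edge D2 -> 'I_4) c1 c2 :
  encodes idx1 c1 -> encodes idx2 c2 ->
  (forall v : vert D1, exists h : edge_end D1, end_vert h = v) ->
  #|vert D1| = #|vert D2| ->
  code_isomorphic c1 c2 -> isomorphic D1 D2.
Proof.
move=> [bij1 next1 paired1] [bij2 next2 paired2] vert_end eq_card.
have [lab2 lab2K idx2K] := bij2.
case/hasP=> p; rewrite mem_permutations => perm_p; rewrite /code_iso all_iota_ord.
move=> /forallP iso_p.
have size_p : size p = 4 by rewrite (perm_size perm_p) size_iota.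
have lt_p (i : 'I_4) : nth 0 p i < 4.
  have: nth 0 p i \in p by rewrite mem_nth // size_p.
  by rewrite (perm_mem perm_p) mem_iota.
pose fE e := lab2 (Ordinal (lt_p (idx1 e))).
have idx_fE e : idx2 (fE e) = nth 0 p (idx1 e) :> nat by rewrite idx2K.
apply: (@isomorphic_of_edges D1 D2 fE) => //.
- apply: inj_card_bij; last by rewrite (bij_eq_card bij1) (bij_eq_card bij2).
  move=> e f eq_ef; apply: (bij_inj bij1); apply/ord_inj/eqP.
  rewrite -(nth_uniq 0 _ _ (s := p)) ?size_p ?ltn_ord //.
    by rewrite -!idx_fE eq_ef.
  by rewrite (perm_uniq perm_p) iota_uniq.
- move=> b e; apply: (bij_inj bij2); apply: ord_inj.
  rewrite next2 !idx_fE next1; apply/eqP.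
  by case/and3P: (andP (iso_p (idx1 e))).1 => // *; case: b.
- move=> e f; rewrite paired1 paired2 !idx_fE.
  have := (andP (iso_p (idx1 e))).2.
  by rewrite all_iota_ord => /forallP/(_ (idx1 f))/eqP.
Qed.

Lemma isomorphic_encodes (D1 D2 : separatrix_diagram)
    (idx1 : edge D1 -> 'I_4) (idx2 : edge D2 -> 'I_4) c1 c2 :
  encodes idx1 c1 -> encodes idx2 c2 ->
  isomorphic D1 D2 -> code_isomorphic c1 c2.
Proof.
move=> [bij1 next1 paired1] [bij2 next2 paired2].
case/isomorphic_edges=> fE [fE_bij fE_next fE_paired].
have [lab1 lab1K idx1K] := bij1.
pose q (i : 'I_4) := val (idx2 (fE (lab1 i))).
have q_inj : injective q.
  move=> i j /val_inj/(bij_inj bij2)/(bij_inj fE_bij) eq_ij.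
  exact: (can_inj idx1K).
(* Entry [i] of [p] is the label in [D2] of the image of the edge labelled [i] in [D1]. *)
pose p := [seq q i | i <- enum 'I_4].
have pE e : nth 0 p (idx1 e) = idx2 (fE e).
  by rewrite (nth_map (idx1 e)) ?size_enum_ord // nth_ord_enum /q lab1K.
apply/hasP; exists p.
  rewrite mem_permutations; apply: perm_eq_iota.
  - by rewrite map_inj_uniq ?enum_uniq.
  - by rewrite size_map size_enum_ord.
  - by apply/allP=> _ /mapP[i _ ->]; apply: ltn_ord.
rewrite /code_iso all_iota_ord; apply/forallP=> i.
rewrite -[i]idx1K; set e := lab1 i.
have next_p b :
  code_next c2 b (nth 0 p (idx1 e)) == nth 0 p (code_next c1 b (idx1 e)).
  by rewrite -next1 !pE -next2 fE_next.
apply/andP; split; first by apply/allP=> b _; apply: next_p.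
rewrite all_iota_ord; apply/forallP=> j.
by rewrite -[j]idx1K !pE -paired1 -paired2 fE_paired.
Qed.

(** * Diagrams of valid codes *)

Section CodeDiagram.

Variable c : code.
Hypothesis c_perm : c.1 \in permutations (iota 0 4).
Hypothesis c_valid : code_valid c.

Let c1_perm : perm_eq c.1 (iota 0 4).
Proof. by rewrite -mem_permutations. Qed.

Let c1_size : size c.1 = 4.
Proof. by rewrite (perm_size c1_perm) size_iota. Qed.

Let c1_uniq : uniq c.1.
Proof. by rewrite (perm_uniq c1_perm) iota_uniq. Qed.

Lemma code_next_lt b (i : 'I_4) : code_next c b i < 4.
Proof.
case: b => /=.
  have: nth 0 c.1 i \in c.1 by rewrite mem_nth // c1_size.
  by rewrite (perm_mem c1_perm) mem_iota.
(* Past its table [swap] takes the default value 0, which is also below 4. *)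
by move: (index _ c.1) => [|[|[|[|[]]]]].
Qed.

Definition ord_next b (i : 'I_4) : 'I_4 := Ordinal (code_next_lt b i).

Lemma ord_nextK (i : 'I_4) : ord_next false (ord_next true i) = swap i :> nat.
Proof. by rewrite /= index_uniq ?c1_size. Qed.

(** For [true], the list has no repetition. For [false], every label is a value of [ord_next true],
    after which [ord_next false] gives the injective [swap]. *)
Lemma ord_next_inj b : injective (ord_next b).
Proof.
have inj_true : injective (ord_next true).
  move=> i j [/eqP]; rewrite nth_uniq ?c1_size // => /eqP.
  exact: val_inj.
case: b => // i j.
have [lab _ labK] := injF_bij inj_true.
rewrite -[i]labK -[j]labK => /(congr1 (@nat_of_ord 4)); rewrite !ord_nextK => eq_ij.
congr (ord_next true _); apply/ord_inj => /=; move: eq_ij.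
by case: (lab i) (lab j) => [[|[|[|[|[]]]]] // ?] [[|[|[|[|[]]]]] // ?].
Qed.

(** The two vertices are the Booleans: they are the orbits {0, 1} and {2, 3} of [swap]. *)
Definition ord_base (i : 'I_4) : bool := i < 2.

Lemma ord_base_next (i j : 'I_4) : reflect
  (exists n, j = iter n (ord_next false \o ord_next true) i)
  (ord_base j == ord_base i).
Proof.
apply: (iffP eqP) => [|[n ->]].
  have [-> _|neq_ji eq_base] := eqVneq j i; first by exists 0.
  exists 1; apply: ord_inj; rewrite [RHS]ord_nextK; move: neq_ji eq_base.
  by case: i j => [[|[|[|[|[]]]]] // ?] [[|[|[|[|[]]]]] // ?].
elim: n => //= n <-; rewrite /ord_base [ord_next false _ : nat]ord_nextK.
by case: (iter n _ i) => [[|[|[|[|[]]]]] // ?].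
Qed.

Definition code_ribbon := next_ribbon ord_next_inj ord_base_next.

Lemma code_ribbon_side b (i j : 'I_4) :
  ((j, b) \in side (G := code_ribbon) i b) = (val j \in code_side c b i).
Proof.
apply: (@encodes_side code_ribbon id); first by exists id.
by move=> d e; rewrite next_ribbon_side_next.
Qed.

Let M : rel 'I_4 := fun i j => code_paired c i j.

Lemma code_total (i : 'I_4) : exists j, M i j.
Proof.
have /and3P[+ _ _] := c_valid; rewrite all_iota_ord => /forallP/(_ i).
by rewrite has_iota_ord => /existsP.
Qed.

Lemma code_surj (j : 'I_4) : exists i, M i j.
Proof.
have /and3P[_ + _] := c_valid; rewrite all_iota_ord => /forallP/(_ j).
by rewrite has_iota_ord => /existsP.
Qed.

Lemma code_side_pair (i j : 'I_4) : M i j ->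
  count (mem (code_side c false i)) (iota 0 4) =
    count (mem (code_side c true j)) (iota 0 4) /\
  forall i' j' : 'I_4,
    let pos := val i' \in code_side c false i in
    let neg := val j' \in code_side c true j in
    (M i' j' -> pos = neg) /\ (pos -> neg -> M i' j').
Proof.
move=> Mij; have /and3P[_ _] := c_valid.
rewrite all_iota_ord => /forallP/(_ i); rewrite all_iota_ord => /forallP/(_ j).
rewrite -/(M i j) Mij => /andP[/eqP-> valid_ij]; split=> // i' j' pos neg.
move: valid_ij; rewrite all_iota_ord => /forallP/(_ i').
rewrite all_iota_ord => /forallP/(_ j')/andP[/implyP eq_pn /implyP Mpn].
by split=> [/eq_pn/eqP|pos_i' neg_j'] //; apply: Mpn; rewrite -/pos -/neg pos_i'.
Qed.

Lemma code_M_side (i j i' j' : 'I_4) : M i j -> M i' j' ->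
  ((i', false) \in side (G := code_ribbon) i false) =
  ((j', true) \in side (G := code_ribbon) j true).
Proof.
by rewrite !code_ribbon_side => /code_side_pair[_ /(_ i' j')[]].
Qed.

Lemma code_M_invariant (i j i' j' : 'I_4) : M i j ->
  (i', false) \in side (G := code_ribbon) i false ->
  (j', true) \in side (G := code_ribbon) j true -> M i' j'.
Proof.
by rewrite !code_ribbon_side => /code_side_pair[_ /(_ i' j')[]].
Qed.

Definition code_separatrix :=
  next_diagram code_M_side code_total code_surj.

Lemma code_realizable : realizable code_separatrix.
Proof.
apply: next_diagram_realizable => i j /code_side_pair[eq_count _].
have card_side_code b (k : 'I_4) : #|side (G := code_ribbon) k b| =
    count (mem (code_side c b k)) (iota 0 4).
  rewrite card_side count_iota_ord; apply: eq_card => x.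
  exact: code_ribbon_side.
by rewrite !card_side_code.
Qed.

Lemma code_diagram_exists : exists D : cylinder_diagram,
  in_H11 D /\ exists idx : edge D -> 'I_4, encodes idx c.
Proof.
exists (CylinderDiagram code_realizable); split.
  split=> [|v]; first exact: card_bool.
  have -> := next_digraph_valence ord_base ord_next_inj v.
  rewrite -sum1dep_card big_mkcond !big_ord_recl big_ord0.
  by case: v.
exists id; split; first by exists id.
  by move=> b i; rewrite next_ribbon_side_next.
exact: next_diagram_paired code_M_invariant _ _.
Qed.

End CodeDiagram.

(** * Labelling and encoding the diagrams of H(1,1) *)

Section H11Encoding.

Variable C : cylinder_diagram.
Hypothesis C_H11 : in_H11 C.

Let porbit_card (h : edge_end C) : #|porbit (Defs.rot C) h| = 4.
Proof. by rewrite rot_orbit; have [_ /(_ (end_vert h))] := C_H11. Qed.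

Lemma H11_vert_end (v : vert C) : exists h : edge_end C, end_vert h = v.
Proof.
have [_ /(_ v) val4] := C_H11; have: 0 < valence v by rewrite val4.
by case/card_gt0P=> h; rewrite inE => /eqP; exists h.
Qed.

Lemma H11_card_edge : #|edge C| = 4.
Proof.
have [card_vert val4] := C_H11.
have: #|{: edge_end C}| = 8.
  rewrite -sum1_card (partition_big (@end_vert C) xpredT) //=.
  rewrite (eq_bigr (fun=> 4)) => [|v _]; last by rewrite sum1dep_card; apply: val4.
  by rewrite sum_nat_const card_vert.
by rewrite card_prod card_bool -[8]/(4 * 2) => /eqP; rewrite eqn_pmul2r // => /eqP.
Qed.

Let turn (e : edge C) := side_next false (side_next true e).

Lemma turn_rot e : (turn e, false) = Defs.rot C (Defs.rot C (e, false)).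
Proof. by rewrite !rotE. Qed.

(** Two applications of [turn] are four rotations, once around a vertex of valence 4. *)
Lemma turnK : involutive turn.
Proof.
move=> e; have := iter_porbit (Defs.rot C) (e, false).
by rewrite porbit_card /= -!turn_rot => -[].
Qed.

Lemma turn_neq e : turn e != e.
Proof.
have := uniq_traject_porbit (Defs.rot C) (e, false).
rewrite porbit_card /= -turn_rot !inE; apply: contraTneq => ->.
by rewrite eqxx orbT.
Qed.

(** Any [f] outside the [turn]-orbit of an edge [e] gives the list [e], [turn e], [f], [turn f]. *)
Lemma H11_labelling : exists s : seq (edge C),
  [/\ uniq s, size s = 4 &
      forall e i, i < 4 -> nth e s (swap i) = turn (nth e s i)].
Proof.
have [e _]: exists e : edge C, e \in predT.
  by apply/card_gt0P; rewrite H11_card_edge.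
have [f]: exists f, f \in ~: [set e; turn e].
  apply/card_gt0P; rewrite cardsCs setCK H11_card_edge cards2.
  by rewrite eq_sym turn_neq.
rewrite !inE negb_or => /andP[neq_fe neq_fte].
have turn_eq x y : (turn x == turn y) = (x == y).
  by rewrite (inj_eq (inv_inj turnK)).
exists [:: e; turn e; f; turn f]; split=> //.
  rewrite /= !inE !negb_or turn_eq -(turn_eq e (turn f)) turnK (eq_sym e f).
  rewrite (eq_sym (turn e) f) neq_fe neq_fte (eq_sym e) (eq_sym f (turn f)).
  by rewrite !turn_neq.
by move=> x [|[|[|[|[]]]]] //= _; rewrite turnK.
Qed.

Lemma H11_encoding : exists (idx : edge C -> 'I_4) (c : code),
  [/\ encodes idx c, c.1 \in permutations (iota 0 4), code_admissible c,
      size c.2 = 4 & all (mem (cycle_roots c.1)) c.2].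
Proof.
have [s [uniq_s size_s s_turn]] := H11_labelling.
have mem_s e : e \in s.
  have eq_card: #|s| = #|edge C|.
    by rewrite (card_uniqP uniq_s) size_s H11_card_edge.
  by rewrite (elimT (subset_cardP eq_card)) // subset_predT.
have lt_index e : index e s < 4 by rewrite -size_s index_mem.
pose idx e := Ordinal (lt_index e).
have nth_idx e x : nth x s (idx e) = e by rewrite nth_index.
have idx_inj : injective idx.
  by move=> e f eq_ef; rewrite -(nth_idx e e) eq_ef nth_idx.
have idx_bij : bijective idx.
  by apply: inj_card_bij; rewrite ?card_ord ?H11_card_edge.
have idx_turn e : idx (turn e) = swap (idx e) :> nat.
  rewrite -{1}(nth_idx e e) -s_turn //= index_uniq // size_s.
  by move: (index e s) (lt_index e) => [|[|[|[|[]]]]].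
(* Among the partners of [e], [g e] has the least label; this makes it a root of its cycle. *)
have /fin_all_exists[g g_min] (e : edge C) : exists f,
    paired e f /\ forall f', paired e f' -> idx f <= idx f'.
  have [f0 ef0] := paired_total e.
  by case: (arg_minnP (fun f => nat_of_ord (idx f)) ef0) => f; exists f.
have gP e : paired e (g e) by case: (g_min e).
pose idx_map (h : edge C -> edge C) := [seq nat_of_ord (idx (h e)) | e <- s].
have idx_mapE h e : nth 0 (idx_map h) (idx e) = idx (h e).
  by rewrite (nth_map e) ?size_s // nth_idx.
pose c : code := (idx_map (side_next true), idx_map g).
have map_next_inj : injective (fun e => nat_of_ord (idx (side_next true e))).
  by move=> x y /ord_inj/idx_inj/side_next_inj.
have c_next : encodes_next idx c.
  case=> e; first by rewrite /= idx_mapE.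
  (* With [e] written as [side_next true (prev e)], its next positive side is [turn (prev e)], and
     [index] recovers the label of [prev e]. *)
  have [prev _ prevK] := injF_bij (@side_next_inj C true).
  rewrite -[e]prevK idx_turn /code_next -[index _ c.1]/(index _ (map _ s)).
  rewrite (index_map (f := fun x => nat_of_ord (idx (side_next true x)))) //.
have c_side := encodes_side idx_bij c_next.
have idxP k : k < 4 -> exists e, k = idx e.
  case: idx_bij => lab _ labK lt_k; exists (lab (Ordinal lt_k)).
  by rewrite labK.
exists idx, c; split.
- split=> // e f; rewrite /code_paired /= idx_mapE -c_side.
  apply/idP/idP => [ef|]; first by rewrite -(paired_side (gP e) ef) side_refl.
  exact: paired_invariant (gP e) (side_refl e false).
- rewrite mem_permutations; apply: perm_eq_iota.
  + by rewrite map_inj_uniq.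
  + by rewrite size_map.
  + by apply/allP=> _ /mapP[e _ ->]; apply: ltn_ord.
- apply/and4P; split.
  (* The edge [f] labelled by a root has a partner [e], and [g e] lies in the cycle of [f]; both
     labels are least, hence equal. *)
  + apply/allP=> r; rewrite mem_filter mem_iota => /andP[/allP root_r /idxP[f def_r]].
    have [e ef] := paired_surj f; have [_ /(_ f ef) le_ge] := g_min e.
    have g_f : (g e, true) \in side f true.
      by rewrite -(paired_side ef (gP e)) side_refl.
    have -> : r = idx (g e);
      last exact: (map_f (fun x => nat_of_ord (idx (g x)))).
    apply/eqP; rewrite eqn_leq {2}def_r le_ge andbT; apply: root_r.
    by rewrite def_r -/(code_side c true _) -c_side.
  (* Consecutive edges of a positive cycle have the same partners, hence the same least one. *)
  + apply/allP=> i; rewrite mem_iota => /idxP[e ->].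
    rewrite -c_next /= !idx_mapE; set e' := side_next false e.
    have e_e' : (e', false) \in side e false.
      by rewrite -bnextE; apply: (mem_porbit _ 1).
    have e'_e : (e, false) \in side e' false.
      by rewrite -(side_eqP e_e') side_refl.
    rewrite eqn_leq (g_min e').2 ?(g_min e).2 //.
      exact: paired_invariant (gP e') e'_e (side_refl _ _).
    exact: paired_invariant (gP e) e_e' (side_refl _ _).
  + apply/allP=> i; rewrite mem_iota => /idxP[e ->].
    apply/allP=> j; rewrite mem_iota => /idxP[f ->].
    rewrite [nth 0 _ (idx e)]idx_mapE [nth 0 _ (idx f)]idx_mapE -c_side.
    apply/implyP=> /eqP/ord_inj/idx_inj eq_g.
    by rewrite (paired_side (gP e) (gP f)) eq_g side_refl.
  + apply/allP=> i; rewrite mem_iota => /idxP[e ->].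
    rewrite [nth 0 _ _]idx_mapE !(encodes_subset idx_bij c_next).
    by rewrite (realizable_paired_subset (diagram_realizable C) (gP e)).
- by rewrite size_map.
(* The whole negative cycle of [g e] consists of partners of [e], so [g e] has the least label in
   it. *)
apply/allP=> _ /mapP[e _ ->]; rewrite [mem _ _]mem_filter.
apply/andP; split; last by rewrite mem_iota; apply: ltn_ord.
apply/allP=> k; rewrite -/(code_side c true _) => /(code_sideP c_next)[f -> gf].
by apply: (g_min e).2; apply: paired_invariant (gP e) (side_refl _ _) gf.
Qed.

End H11Encoding.

(** * Classification up to isomorphism *)

Theorem proposition3p3 :
  exists D : 'I_4 -> cylinder_diagram,
    [/\ forall i : 'I_4, in_H11 (D i),
        forall i j : 'I_4, isomorphic (D i) (D j) -> i = j
      & forall C : cylinder_diagram, in_H11 C ->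
          exists i : 'I_4, isomorphic C (D i)].
Proof.
have /fin_all_exists[D D_spec] (i : 'I_4) : exists D : cylinder_diagram,
    in_H11 D /\ exists idx : edge D -> 'I_4, encodes idx (canonical i).
  have c_i : canonical i \in canonical_codes by apply: mem_nth; apply: ltn_ord.
  have /andP[] := allP canonical_valid _ c_i.
  exact: code_diagram_exists.
exists D; split=> [i|i j iso_ij|C C_H11]; first by case: (D_spec i).
  have [_ [idx_i enc_i]] := D_spec i; have [_ [idx_j enc_j]] := D_spec j.
  have := isomorphic_encodes enc_i enc_j iso_ij; have := canonical_distinct.
  rewrite all_iota_ord => /forallP/(_ i); rewrite all_iota_ord => /forallP/(_ j).
  by move/implyP=> distinct_ij /distinct_ij/eqP/ord_inj.
have [idx [[a g] [/= enc a_perm]]] := H11_encoding C_H11.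
(* The enumeration runs over explicit lists of four entries, so [g] is split according to its
   size. *)
case: g enc => [|g0 [|g1 [|g2 [|g3 []]]]] //= enc admissible _.
case/and5P=> root0 root1 root2 root3 _.
have := allP canonical_complete a a_perm.
move=> /allP/(_ _ root0)/allP/(_ _ root1)/allP/(_ _ root2)/allP/(_ _ root3).
rewrite /code_classified admissible has_iota_ord => /existsP[i iso_i]; exists i.
have [[card_vert _] [idx_i enc_i]] := D_spec i.
apply: encodes_isomorphic enc enc_i (H11_vert_end C_H11) _ iso_i.
by rewrite card_vert; case: C_H11.
Qed.
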